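(* Let $\mathcal{D}$ be a model for the formal mathematical system $[M;\mathcal{L}]$, and let $[\hat M;\hat{\mathcal{L}}]$ be the extension of $[M;\mathcal{L}]$ by the names of the individuals of $\mathcal{D}$. Then for every formula $F$ in $[\hat M;\hat{\mathcal{L}}]$: $$F\in\Pi(\hat M;\hat{\mathcal{L}})\ \Rightarrow\ F\text{ is valid in }\mathcal{D},$$ where $\Pi(\hat M;\hat{\mathcal{L}})$ denotes the set of provable formulas in $[\hat M;\hat{\mathcal{L}}]$.
   Context: **Syntax.** $X=\{\mathbf{x}_1,\mathbf{x}_2,\ldots\}$ is the countably infinite alphabet of variables. Let $A$ be a set of constant/operation symbols and $P$ a set of predicate symbols. $A$-lists are the strings generated by: every $x\in X$ and every $a\in A$ is an $A$-list; if $\lambda$ is an $A$-list and $f\in A$ then $f(\lambda)$ is an $A$-list; if $\lambda,\mu$ are $A$-lists then the concatenation $\lambda\mu$ is an $A$-list. $\mathrm{var}(\lambda)$ is the set of variables occurring in $\lambda$; $\lambda\frac{\mu}{x}$ is the list obtained by replacing $x$ everywhere in $\lambda$ by $\mu$. Formulas are written in prefix notation. Prime formulas are $\sim\lambda,\mu$ (equality), $p$, and $p\,\lambda_1,\ldots,\lambda_n$ for $p\in P$, $n\ge1$ and argument lists $\lambda,\mu,\lambda_i$ (a predicate symbol may be used with any number of arguments). If $F,G$ are formulas and $x\in X$, then $\neg F$, $\to FG$, $\leftrightarrow FG$, $\&FG$, $\vee FG$, $\forall xF$, $\exists xF$ are formulas. $\mathrm{free}(F)$ is the set of variables occurring free in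 $F$; $F$ is closed if $\mathrm{free}(F)=\emptyset$. $F\frac{\lambda}{x}=\mathrm{SbF}(F;\lambda;x)$ is the result of replacing every free occurrence of $x$ in $F$ by $\lambda$. The condition $\mathrm{CF}(F;\lambda;x)$ says that this substitution is collision-free: no free occurrence of $x$ in $F$ lies in the scope of a quantifier $\forall y$ or $\exists y$ with $y\in\mathrm{var}(\lambda)$. **Formal mathematical systems.** $[M;\mathcal{L}]$ with $M=[A;P;B]$ consists of $A$, $P$, a set $\mathcal{L}$ of $A$-lists with $X\subseteq\mathcal{L}$ and $\lambda\frac{\mu}{x}\in\mathcal{L}$ for all $\lambda,\mu\in\mathcal{L}$, $x\in X$, and a set $B$ of formulas (basis axioms) with all argument lists in $\mathcal{L}$. Formulas of $[M;\mathcal{L}]$ are the formulas over $A,P$ all of whose argument lists are in $\mathcal{L}$. $\Pi(M;\mathcal{L})$ is the set of formulas of $[M;\mathcal{L}]$ provable by the following Hilbert-style calculus, in which all formulas have argument lists in $\mathcal{L}$. Axioms: the formulas in $B$; all $\alpha(F_1,\ldots,F_j)$ for propositional tautologies $\alpha$; equality axioms $\sim x,x$; $\to\mathrm{SbF}(\sim\lambda,\mu;x;y)\to\sim x,y\,\sim\lambda,\mu$ ($x,y\in X$, $\lambda,\mu\in\mathcal{L}$); $\to\sim x_1,y_1\ldots\to\sim x_n,y_n\to p\,x_1,\ldots,x_n\;p\,y_1,\ldots,y_n$ ($p\in P$, $n\ge1$, $x_i,y_i\in X$); quantifier axioms $\to\forall xF\,F$; $\to\forall x\to FG\;\to F\,\forall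 xG$ if $x\notin\mathrm{free}(F)$; $\leftrightarrow\neg\forall x\neg F\;\exists xF$. Rules: (a) axioms may be written down; (b) from $F$ and $\to FG$ infer $G$; (c) from $F$ infer $F\frac{\lambda}{x}$ if $x\in X$, $\lambda\in\mathcal{L}$ and $\mathrm{CF}(F;\lambda;x)$; (d) from $F$ infer $\forall xF$. **Models.** A model $\mathcal{D}$ of $[M;\mathcal{L}]$ consists of: (1) a nonempty set $\mathcal{D}_*$ (universe; its members are individuals); (2) for each $d\in\mathcal{D}_*$ exactly one name $\alpha_d$, with different individuals having different names; $\mathcal{N}=\{\alpha_d:d\in\mathcal{D}_*\}$ consists of symbols different from those of $[M;\mathcal{L}]$; (3) the extended system $[\hat M;\hat{\mathcal{L}}]$ with $\hat A=A\cup\mathcal{N}$, $\hat M=[\hat A;P;B]$, $\hat{\mathcal{L}}=\{\lambda\frac{\kappa_1}{x_1}\ldots\frac{\kappa_m}{x_m}:\lambda\in\mathcal{L},x_i\in X,\kappa_i\in\mathcal{N},m\ge0\}$; $\hat{\mathcal{L}}_*$ is the set of $\lambda\in\hat{\mathcal{L}}$ with $\mathrm{var}(\lambda)=\emptyset$; (4) a surjective function $\mathcal{D}:\hat{\mathcal{L}}_*\to\mathcal{D}_*$ with $\mathcal{D}(\lambda\frac{\mu}{x})=\mathcal{D}(\lambda\frac{\alpha_{\mathcal{D}(\mu)}}{x})$ for all $\mu\in\hat{\mathcal{L}}_*$, $x\in X$, $\lambda\in\hat{\mathcal{L}}$ with $\mathrm{var}(\lambda)\subseteq\{x\}$; (5)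 for each $p\in P$ and $n\in\mathbb{N}_0$ an $n$-ary predicate $p_n\subseteq\mathcal{D}_*^n$, where for $n=0$, $p_0\in\{\top,\bot\}$ is a truth value; (6) an extension of $\mathcal{D}$ assigning a truth value to each closed formula of $[\hat M;\hat{\mathcal{L}}]$: $\mathcal{D}(\sim\lambda,\mu)=\top$ iff $\mathcal{D}(\lambda)=\mathcal{D}(\mu)$; $\mathcal{D}(p)=p_0$; $\mathcal{D}(p\,\lambda_1,\ldots,\lambda_n)=\top$ iff $(\mathcal{D}(\lambda_1),\ldots,\mathcal{D}(\lambda_n))\in p_n$; the connectives $\neg,\to,\leftrightarrow,\&,\vee$ are interpreted classically; for $\mathrm{free}(F)\subseteq\{x\}$, $\mathcal{D}(\forall xF)=\top$ iff $\mathcal{D}(F\frac{\lambda}{x})=\top$ for all $\lambda\in\hat{\mathcal{L}}_*$, and $\mathcal{D}(\exists xF)=\top$ iff $\mathcal{D}(F\frac{\lambda}{x})=\top$ for some $\lambda\in\hat{\mathcal{L}}_*$; (7) a formula $F$ of $[\hat M;\hat{\mathcal{L}}]$ with $\mathrm{free}(F)=\{x_1,\ldots,x_m\}$ is called valid in $\mathcal{D}$ iff $\mathcal{D}(F\frac{\lambda_1}{x_1}\ldots\frac{\lambda_m}{x_m})=\top$ for all $\lambda_1,\ldots,\lambda_m\in\hat{\mathcal{L}}_*$; (8) every $F\in B$ is valid in $\mathcal{D}$. *)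

(* Defs.v *)
From mathcomp Require Import all_boot.

Set Implicit Arguments.
Unset Strict Implicit.
Unset Printing Implicit Defensive.

(** * Strings and A-lists *)

(** The variables x_1, x_2, ... are represented by their indices in [nat]. *)
Inductive symbol (A : Type) : Type :=
| SVar of nat
| SConst of A
| SLpar
| SRpar.

Arguments SVar {A} _.
Arguments SLpar {A}.
Arguments SRpar {A}.

Definition string (A : Type) : Type := seq (symbol A).

Definition svar {A : Type} (x : nat) : string A := [:: SVar x].
Definition sconst {A : Type} (a : A) : string A := [:: SConst a].

Inductive is_alist (A : Type) : string A -> Prop :=
| alist_var x : is_alist (svar x)
| alist_const a : is_alist (sconst a)
| alist_app f l : is_alist l -> is_alist (SConst f :: SLpar :: l ++ [:: SRpar])
| alist_cat l m : is_alist l -> is_alist m -> is_alist (l ++ m).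

Definition vars (A : Type) (l : string A) : seq nat :=
  pmap (fun s => if s is SVar x then Some x else None) l.

(** [lsubst l mu x] is the list l with x replaced everywhere by mu. *)
Definition lsubst (A : Type) (l mu : string A) (x : nat) : string A :=
  flatten [seq (if s is SVar y then if y == x then mu else [:: s] else [:: s])
          | s <- l].

(** * Formulas *)

(** Abstract syntax replaces the prefix notation; [FPred p [::]] is the prime
    formula p, and p may be followed by any number of argument lists. *)
Inductive formula (A P : Type) : Type :=
| FEq of string A & string A
| FPred of P & seq (string A)
| FNeg of formula A P
| FImp of formula A P & formula A P
| FIff of formula A P & formula A P
| FAnd of formula A P & formula A P
| FOr of formula A P & formula A P
| FAll of nat & formula A P
| FEx of nat & formula A P.

Arguments FEq {A P} _ _.

Fixpoint free (A P : Type) (F : formula A P) : seq nat :=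
  match F with
  | FEq l m => vars l ++ vars m
  | FPred _ ls => flatten (map (@vars A) ls)
  | FNeg G => free G
  | FImp G H | FIff G H | FAnd G H | FOr G H => free G ++ free H
  | FAll x G | FEx x G => [seq y <- free G | y != x]
  end.

(** [SbF F lam x] replaces every free occurrence of x in F by lam, without any
    renaming of bound variables. *)
Fixpoint SbF (A P : Type) (F : formula A P) (lam : string A) (x : nat) :
    formula A P :=
  match F with
  | FEq l m => FEq (lsubst l lam x) (lsubst m lam x)
  | FPred p ls => FPred p [seq lsubst l lam x | l <- ls]
  | FNeg G => FNeg (SbF G lam x)
  | FImp G H => FImp (SbF G lam x) (SbF H lam x)
  | FIff G H => FIff (SbF G lam x) (SbF H lam x)
  | FAnd G H => FAnd (SbF G lam x) (SbF H lam x)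
  | FOr G H => FOr (SbF G lam x) (SbF H lam x)
  | FAll y G => if y == x then F else FAll y (SbF G lam x)
  | FEx y G => if y == x then F else FEx y (SbF G lam x)
  end.

(** No free occurrence of x in F lies in the scope of a quantifier binding a
    variable of lam. *)
Fixpoint CF (A P : Type) (F : formula A P) (lam : string A) (x : nat) : bool :=
  match F with
  | FEq _ _ | FPred _ _ => true
  | FNeg G => CF G lam x
  | FImp G H | FIff G H | FAnd G H | FOr G H => CF G lam x && CF H lam x
  | FAll y G | FEx y G =>
      (x \notin free F) || (y \notin vars lam) && CF G lam x
  end.

Fixpoint args_in (A P : Type) (L : string A -> Prop) (F : formula A P) : Prop :=
  match F with
  | FEq l m => L l /\ L m
  | FPred _ ls => forall i, i < size ls -> L (nth [::] ls i)
  | FNeg G => args_in L G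
  | FImp G H | FIff G H | FAnd G H | FOr G H => args_in L G /\ args_in L H
  | FAll _ G | FEx _ G => args_in L G
  end.

(** * Formal mathematical systems [M; L] with M = [A; P; B] *)

Record fms (A P : Type) : Type := Fms {
  lists : string A -> Prop;
  basis : formula A P -> Prop
}.

Definition formula_of (A P : Type) (S : fms A P) (F : formula A P) : Prop :=
  args_in (lists S) F.

Record is_fms (A P : Type) (S : fms A P) : Prop := IsFms {
  lists_alist : forall l, lists S l -> is_alist l;
  lists_var : forall x, lists S (svar x);
  lists_subst : forall l mu x,
    lists S l -> lists S mu -> lists S (lsubst l mu x);
  basis_formula : forall F, basis S F -> formula_of S F
}.

(** * The Hilbert calculus *)

Inductive pform : Type :=
| PVar of nat
| PNeg of pform
| PImp of pform & pform
| PIff of pform & pform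
| PAnd of pform & pform
| POr of pform & pform.

Fixpoint peval (v : nat -> bool) (a : pform) : bool :=
  match a with
  | PVar i => v i
  | PNeg b => ~~ peval v b
  | PImp b c => peval v b ==> peval v c
  | PIff b c => peval v b == peval v c
  | PAnd b c => peval v b && peval v c
  | POr b c => peval v b || peval v c
  end.

Definition tautology (a : pform) : Prop := forall v, peval v a.

Fixpoint pinst (A P : Type) (Fs : nat -> formula A P) (a : pform) :
    formula A P :=
  match a with
  | PVar i => Fs i
  | PNeg b => FNeg (pinst Fs b)
  | PImp b c => FImp (pinst Fs b) (pinst Fs c)
  | PIff b c => FIff (pinst Fs b) (pinst Fs c)
  | PAnd b c => FAnd (pinst Fs b) (pinst Fs c)
  | POr b c => FOr (pinst Fs b) (pinst Fs c)
  end.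

(** For s = (x_1, y_1), ..., (x_n, y_n):
    x_1 = y_1 -> ... -> x_n = y_n -> p x_1, ..., x_n -> p y_1, ..., y_n. *)
Definition pred_cong (A P : Type) (p : P) (s : seq (nat * nat)) : formula A P :=
  foldr (fun xy G => FImp (FEq (svar xy.1) (svar xy.2)) G)
        (FImp (FPred p [seq svar xy.1 | xy <- s])
              (FPred p [seq svar xy.2 | xy <- s]))
        s.

Inductive log_axiom (A P : Type) : formula A P -> Prop :=
| ax_taut a Fs : tautology a -> log_axiom (pinst Fs a)
| ax_refl x : log_axiom (FEq (svar x) (svar x))
| ax_eq l m x y :
    log_axiom (FImp (SbF (FEq l m) (svar x) y)
                    (FImp (FEq (svar x) (svar y)) (FEq l m)))
| ax_cong p s : 0 < size s -> log_axiom (pred_cong A p s)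
| ax_all_elim x F : log_axiom (FImp (FAll x F) F)
| ax_all_imp x F G : x \notin free F ->
    log_axiom (FImp (FAll x (FImp F G)) (FImp F (FAll x G)))
| ax_ex x F : log_axiom (FIff (FNeg (FAll x (FNeg F))) (FEx x F)).

(** [provable S] is the set Pi(M; L) of provable formulas. *)
Inductive provable (A P : Type) (S : fms A P) : formula A P -> Prop :=
| prov_basis F : basis S F -> provable S F
| prov_axiom F : log_axiom F -> formula_of S F -> provable S F
| prov_mp F G : provable S F -> provable S (FImp F G) -> provable S G
| prov_subst F lam x : provable S F -> lists S lam -> CF F lam x ->
    provable S (SbF F lam x)
| prov_gen F x : provable S F -> provable S (FAll x F).

(** * Extension of the constant symbols *)

Definition map_symbol (A A' : Type) (h : A -> A') (s : symbol A) : symbol A' :=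
  match s with
  | SVar x => SVar x
  | SConst a => SConst (h a)
  | SLpar => SLpar
  | SRpar => SRpar
  end.

Definition map_string (A A' : Type) (h : A -> A') : string A -> string A' :=
  map (map_symbol h).

Fixpoint map_formula (A A' P : Type) (h : A -> A') (F : formula A P) :
    formula A' P :=
  match F with
  | FEq l m => FEq (map_string h l) (map_string h m)
  | FPred p ls => FPred p (map (map_string h) ls)
  | FNeg G => FNeg (map_formula h G)
  | FImp G H => FImp (map_formula h G) (map_formula h H)
  | FIff G H => FIff (map_formula h G) (map_formula h H)
  | FAnd G H => FAnd (map_formula h G) (map_formula h H)
  | FOr G H => FOr (map_formula h G) (map_formula h H)
  | FAll x G => FAll x (map_formula h G)
  | FEx x G => FEx x (map_formula h G)
  end.

(** The symbols of N are new because the extended alphabet is the disjoint sum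
    A + N. *)
Definition name_list (A N : Type) (k : N) : string (A + N) := sconst (inr k).

Definition ext_fms (A P : Type) (S : fms A P) (N : Type) : fms (A + N) P :=
  Fms
    (fun nu => exists (l : string A) (s : seq (nat * N)), lists S l /\
       nu = foldl (fun m xk => lsubst m (name_list A xk.2) xk.1)
                  (map_string inl l) s)
    (fun F => exists2 G, basis S G & F = map_formula inl G).

(** * Models *)

(** [value] and [truth] are total functions, but they are constrained and used
    only on the variable-free lists, respectively closed formulas, of the
    extended system.  [pred_of p] collects the predicates p_n for all n: p_n is the
    restriction of [pred_of p] to sequences of length n. *)
Record interpretation (A P : Type) : Type := Interpretation {
  indiv : Type;
  names : Type;
  name : indiv -> names;
  value : string (A + names) -> indiv;
  pred_of : P -> seq indiv -> Prop;
  truth : formula (A + names) P -> Prop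
}.

Section Model.
Variables (A P : Type) (S : fms A P) (D : interpretation A P).

Definition extended : fms (A + names D) P := ext_fms S (names D).

Definition closed_list (l : string (A + names D)) : Prop :=
  lists extended l /\ vars l = [::].

Definition sentence (F : formula (A + names D) P) : Prop :=
  formula_of extended F /\ free F = [::].

(** [xs] enumerates free(F) = {x_1, ..., x_m}, and [lam x_i] is the closed list
    substituted for x_i. *)
Definition valid (F : formula (A + names D) P) : Prop :=
  forall (xs : seq nat) (lam : nat -> string (A + names D)),
    uniq xs -> xs =i free F ->
    (forall x, x \in xs -> closed_list (lam x)) ->
    truth (foldl (fun G x => SbF G (lam x) x) F xs).

Record is_model : Prop := IsModel {
  indiv_nonempty : inhabited (indiv D);
  name_inj : injective (@name A P D);
  name_surj : forall k : names D, exists d, name d = k;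
  value_surj : forall d : indiv D, exists2 l, closed_list l & value l = d;
  value_subst : forall mu x l, closed_list mu -> lists extended l ->
    {subset vars l <= [:: x]} ->
    value (lsubst l mu x) = value (lsubst l (name_list A (name (value mu))) x);
  truth_eq : forall l m, sentence (FEq l m) ->
    (truth (FEq l m) <-> value l = value m);
  truth_pred : forall p ls, sentence (FPred p ls) ->
    (truth (FPred p ls) <-> pred_of p (map (@value A P D) ls));
  truth_neg : forall F, sentence (FNeg F) -> (truth (FNeg F) <-> ~ truth F);
  truth_imp : forall F G, sentence (FImp F G) ->
    (truth (FImp F G) <-> (truth F -> truth G));
  truth_iff : forall F G, sentence (FIff F G) ->
    (truth (FIff F G) <-> (truth F <-> truth G));
  truth_and : forall F G, sentence (FAnd F G) ->
    (truth (FAnd F G) <-> truth F /\ truth G);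
  truth_or : forall F G, sentence (FOr F G) ->
    (truth (FOr F G) <-> truth F \/ truth G);
  truth_all : forall x F, sentence (FAll x F) ->
    (truth (FAll x F) <-> forall l, closed_list l -> truth (SbF F l x));
  truth_ex : forall x F, sentence (FEx x F) ->
    (truth (FEx x F) <-> exists2 l, closed_list l & truth (SbF F l x));
  basis_valid : forall F, basis extended F -> valid F
}.

End Model.

Arguments valid {A P} S D F.

(* Main.v *)
From mathcomp Require Import all_boot.
From mathcomp.classical Require Import boolp.
Require Import Defs.

(** The truth of a sentence in a model is defined through the closed lists that
    may be substituted for its variables.  The proof replaces this by Tarski
    satisfaction [sat F e], where e assigns an individual to every variable and
    a list is evaluated by putting the names of these individuals for its
    variables.  Four facts carry the argument.

    - Lists: the value of a list in which closed lists are substituted for the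
      variables depends only on the values of these closed lists
      ([eq_value_ssub]).  The model only grants this for lists with a single
      variable, so the variables are exchanged one by one; that the
      intermediate lists belong to the extended system is [ext_lists_subst],
      where the names are first moved to fresh variables.
    - Substitution: under CF(F; lam; x), the formula F(lam/x) is satisfied by e
      iff F is satisfied by e with x sent to the value of lam ([sat_SbF]).
    - Truth: a sentence is true iff it is satisfied by any assignment
      ([truth_sat]).  In the case of a quantifier this uses that every
      individual is the value of a closed list.
    - Validity: a formula is valid iff it is satisfied by all assignments
      ([valid_sat]).

    After this translation the soundness of the calculus ([provable_sat]) is
    the usual induction on proofs: satisfaction by all assignments holds for
    the logical axioms and passes through the rules, the substitution rule
    being the second fact.  Propositional tautologies and the axiom relating
    the two quantifiers require classical logic. *)

Set Implicit Arguments.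
Unset Strict Implicit.
Unset Printing Implicit Defensive.

(** * Simultaneous substitution in lists *)

Section SimultaneousSubstitution.
Variable A : Type.
Implicit Types (l mu : string A) (u v : nat -> string A).

(** The list l with every variable y replaced by v y, all at the same time.
    Unlike iterated replacement, this composes without side conditions
    ([ssub_comp]). *)
Definition ssub l v : string A :=
  flatten [seq (if s is SVar y then v y else [:: s]) | s <- l].

Lemma lsubst_ssub l mu x :
  lsubst l mu x = ssub l (fun y => if y == x then mu else svar y).
Proof.
by rewrite /lsubst /ssub; congr flatten; apply: eq_map => -[y|a||].
Qed.

Lemma ssub_cat l mu v : ssub (l ++ mu) v = ssub l v ++ ssub mu v.
Proof. by rewrite /ssub map_cat flatten_cat. Qed.

Lemma vars_cat l mu : vars (l ++ mu) = vars l ++ vars mu.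
Proof. by rewrite /vars pmap_cat. Qed.

Lemma ssub_svar x v : ssub (svar x) v = v x.
Proof. by rewrite /ssub /= cats0. Qed.

Lemma ssub_comp l u v : ssub (ssub l u) v = ssub l (fun y => ssub (u y) v).
Proof.
elim: l => [|s l IH] //.
rewrite -[s :: l]/([:: s] ++ l) !ssub_cat IH; congr (_ ++ _).
by case: s => [x|a||] //; rewrite !ssub_svar.
Qed.

Lemma eq_ssub l u v : {in vars l, u =1 v} -> ssub l u = ssub l v.
Proof.
elim: l => [|s l IH] // uv.
rewrite -[s :: l]/([:: s] ++ l) !ssub_cat IH => [|y yl]; last first.
  by apply: uv; rewrite -[s :: l]/([:: s] ++ l) vars_cat mem_cat yl orbT.
congr (_ ++ _); case: s uv => [x|a||] // uv.
by rewrite !ssub_svar uv //= inE eqxx.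
Qed.

Lemma ssub_id l : ssub l svar = l.
Proof. by elim: l => [|[x|a||] l IH] //=; rewrite /ssub /=; congr (_ :: _). Qed.

Lemma ssub_closed l v : vars l = [::] -> ssub l v = l.
Proof.
by move=> l0; rewrite -[RHS]ssub_id; apply: eq_ssub => x; rewrite l0.
Qed.

Lemma vars_ssub l v : vars (ssub l v) = flatten [seq vars (v y) | y <- vars l].
Proof.
elim: l => [|s l IH] //.
rewrite -[s :: l]/([:: s] ++ l) ssub_cat !vars_cat map_cat flatten_cat IH.
by congr (_ ++ _); case: s => [x|a||] //=; rewrite /ssub /= !cats0.
Qed.

Lemma lsubst_notin l mu x : x \notin vars l -> lsubst l mu x = l.
Proof.
move=> xl; rewrite lsubst_ssub -[RHS]ssub_id; apply: eq_ssub => y yl.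
by case: eqP xl => // <-; rewrite yl.
Qed.

Lemma lsubst_trans l mu x z :
  z \notin vars l -> lsubst (lsubst l (svar z) x) mu z = lsubst l mu x.
Proof.
move=> zl; rewrite !lsubst_ssub ssub_comp; apply: eq_ssub => y yl.
case: (y =P x) => _; rewrite ssub_svar ?eqxx //.
by case: eqP zl => // <-; rewrite yl.
Qed.

Lemma lsubst_comm l mu nu x y : x != y -> x \notin vars nu ->
  lsubst (lsubst l mu x) nu y = lsubst (lsubst l nu y) (lsubst mu nu y) x.
Proof.
move=> xy xnu; rewrite !lsubst_ssub !ssub_comp; apply: eq_ssub => z _.
case: (z =P x) => [->|/eqP zx].
  by rewrite (negbTE xy) ssub_svar eqxx.
rewrite ssub_svar; case: (z =P y) => _.
  by rewrite -lsubst_ssub lsubst_notin.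
by rewrite ssub_svar (negbTE zx).
Qed.

Lemma vars_lsubst_closed l mu x :
  vars mu = [::] -> vars (lsubst l mu x) = [seq y <- vars l | y != x].
Proof.
move=> mu0; rewrite lsubst_ssub vars_ssub.
by elim: (vars l) => //= y s ->; case: eqP => //; rewrite mu0.
Qed.

End SimultaneousSubstitution.

(** * Closure of the extended lists under substitution *)

Section ExtendedLists.
Variables (A P : Type) (S : fms A P) (N : Type).
Hypothesis hS : is_fms S.
Implicit Types (l mu : string (A + N)) (s : seq (nat * N)).

Notation E := (lists (ext_fms S N)).

(** The list l with the names of s substituted one after the other. *)
Definition name_subst l s :=
  foldl (fun m xk => lsubst m (name_list A xk.2) xk.1) l s.

Lemma map_string_lsubst (l mu : string A) x :
  map_string (@inl A N) (lsubst l mu x) =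
  lsubst (map_string inl l) (map_string inl mu) x.
Proof.
rewrite /map_string /lsubst map_flatten -!map_comp.
congr flatten; apply: eq_map => -[y|a||] //=.
by case: eqP.
Qed.

Lemma name_subst_lsubst l mu x s : x \notin map fst s ->
  name_subst (lsubst l mu x) s = lsubst (name_subst l s) (name_subst mu s) x.
Proof.
elim: s l mu => [|[y k] s IH] l mu //=; rewrite inE negb_or => /andP[xy xs].
by rewrite lsubst_comm // IH.
Qed.

Lemma name_subst_notin l s :
  {in map fst s, forall x, x \notin vars l} -> name_subst l s = l.
Proof.
elim: s => [|[y k] s IH] //= h.
rewrite lsubst_notin; last by apply: h; rewrite inE eqxx.
by apply: IH => x xs; apply: h; rewrite inE xs orbT.
Qed.

Lemma fresh_var (xs : seq nat) K : exists2 z, K <= z & z \notin xs.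
Proof.
exists (K + sumn xs).+1; first by rewrite -addnS leq_addr.
have lt_sum y ys : y \in ys -> y <= sumn ys.
  elim: ys => //= a ys IH; rewrite inE => /predU1P[->|/IH h].
    exact: leq_addr.
  exact: leq_trans h (leq_addl _ _).
apply/negP => /lt_sum; rewrite leqNgt ltnS leq_addl.
by [].
Qed.

(** The variables replaced by names in a member of the extended lists may be
    renamed to variables of index at least K, hence outside any given finite
    set of variables. *)
Lemma name_subst_rename (l : string A) s K : lists S l ->
  exists (l' : string A) s', [/\ lists S l', {in map fst s', forall x, K <= x} &
    name_subst (map_string inl l) s = name_subst (map_string inl l') s'].
Proof.
elim/last_ind: s K => [|s [x k] IH] K Sl; first by exists l, [::]; split.
have [l' [s' [Sl' K' e]]] := IH (maxn K x.+1) Sl.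
(* The variable x of l' is renamed to a fresh z, which then receives k. *)
set m := name_subst (map_string inl l) s in e.
have [z Kz] := fresh_var (vars m ++ map fst s') K.
rewrite mem_cat negb_or => /andP[zm zs'].
have xs' : x \notin map fst s'.
  by apply/negP => /K'; rewrite geq_max ltnn andbF.
exists (lsubst l' (svar z) x), (rcons s' (z, k)); split.
- by apply: lists_subst hS _ _ _ _ _ => //; exact: lists_var.
- move=> y; rewrite map_rcons mem_rcons inE => /predU1P[->//|/K'].
  by rewrite geq_max => /andP[].
- rewrite /name_subst -!cats1 !foldl_cat /= -/(name_subst _ s) -/m.
  rewrite -/(name_subst _ s') map_string_lsubst name_subst_lsubst // -e.
  rewrite [name_subst (map_string _ (svar z)) _]name_subst_notin.
    by rewrite lsubst_trans.
  by move=> y ys' /=; rewrite inE; apply: contraNneq zs' => <-.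
Qed.

(** If l comes from l1 in L by putting names for the variables of s, and mu from
    mu1 by putting names for the variables of t, then l(mu/x) comes from
    l1(mu1/x) by s followed by t, provided that s avoids x and mu1, and t avoids
    x and l. *)
Lemma ext_lists_subst l mu x : E l -> E mu -> E (lsubst l mu x).
Proof.
move=> El [mu0 [t0 [Smu0 emu0]]].
have bnd (xs : seq nat) : exists K, forall y, y \in xs -> y < K.
  exists (\max_(y <- xs) y).+1 => y yxs.
  by rewrite ltnS; apply: (@leq_bigmax_seq _ xs predT (fun i => i)).
have [K hK] := bnd (x :: vars l).
have [mu1 [t [Smu Kt et]]] := name_subst_rename t0 K Smu0.
have [K2 hK2] := bnd (x :: vars (map_string (@inl A N) mu1)).
case: El => l0 [s0 [Sl0 el0]].
have [l1 [s [Sl Ks es]]] := name_subst_rename s0 K2 Sl0.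
have el : l = name_subst (map_string inl l1) s by rewrite -es.
have emu : mu = name_subst (map_string inl mu1) t by rewrite -et.
have avoid (r : seq (nat * N)) (xs : seq nat) M :
    {in map fst r, forall y, M <= y} -> (forall y, y \in xs -> y < M) ->
    {in map fst r, forall y, y \notin xs}.
  by move=> h1 h2 y /h1 My; apply/negP => /h2; rewrite ltnNge My.
have as_ := avoid _ _ _ Ks hK2; have at_ := avoid _ _ _ Kt hK.
exists (lsubst l1 mu1 x), (s ++ t); split; first exact: lists_subst.
rewrite foldl_cat -/(name_subst _ s) -/(name_subst _ t) map_string_lsubst.
rewrite name_subst_lsubst; last first.
  by apply/negP => /as_; rewrite inE eqxx.
rewrite -el [name_subst (map_string _ mu1) s]name_subst_notin; last first.
  by move=> y /as_; rewrite inE negb_or => /andP[].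
rewrite name_subst_lsubst; last first.
  by apply/negP => /at_; rewrite inE eqxx.
rewrite -emu name_subst_notin //.
by move=> y /at_; rewrite inE negb_or => /andP[].
Qed.

Lemma ext_lists_var x : E (svar x).
Proof. by exists (svar x), [::]; split => //; apply: lists_var. Qed.

Lemma ext_lists_name k : E (name_list A k).
Proof.
by exists (svar 0), [:: (0, k)]; split => //; apply: lists_var.
Qed.

(** Since each v x is closed or is x itself, the simultaneous substitution can
    be performed sequentially. *)
Lemma ext_lists_ssub l v : E l ->
  (forall x, v x = svar x \/ E (v x) /\ vars (v x) = [::]) -> E (ssub l v).
Proof.
move=> El hv.
have -> : ssub l v = ssub l (fun y => if y \in vars l then v y else svar y).
  by apply: eq_ssub => y ->.
elim: (vars l) => [|x xs IH]; first by rewrite ssub_id.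
have Ev : E (v x) by case: (hv x) => [->|[]//]; apply: ext_lists_var.
have := ext_lists_subst x IH Ev; rewrite lsubst_ssub ssub_comp.
congr (E _); apply: eq_ssub => y _; rewrite inE.
case: (y =P x) => [->|/eqP yx] /=; case: ifP => _.
- case: (hv x) => [e|[_ c]]; first by rewrite {1}e ssub_svar eqxx.
  by rewrite ssub_closed.
- by rewrite ssub_svar eqxx.
- case: (hv y) => [->|[_ c]]; first by rewrite ssub_svar (negbTE yx).
  by rewrite ssub_closed.
- by rewrite ssub_svar (negbTE yx).
Qed.

End ExtendedLists.

(** * Formulas *)

Section Formulas.
Variables A P : Type.
Implicit Types (F G : formula A P) (lam : string A) (x : nat).

Lemma args_in_SbF (L : string A -> Prop) F lam x :
  (forall l, L l -> L (lsubst l lam x)) -> args_in L F ->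
  args_in L (SbF F lam x).
Proof.
move=> hL; elim: F => //=.
- by move=> l m [/hL ? /hL].
- move=> p ls h i; rewrite size_map => ils.
  by rewrite (nth_map [::]) //; apply/hL/h.
- by move=> G IG H IH [/IG ? /IH].
- by move=> G IG H IH [/IG ? /IH].
- by move=> G IG H IH [/IG ? /IH].
- by move=> G IG H IH [/IG ? /IH].
- by move=> y G IG h; case: eqP => /= _; [|exact: IG].
- by move=> y G IG h; case: eqP => /= _; [|exact: IG].
Qed.

Lemma filter_neq_comm (s : seq nat) x y :
  [seq z <- [seq z <- s | z != x] | z != y] =
  [seq z <- [seq z <- s | z != y] | z != x].
Proof. by rewrite -!filter_predI; apply: eq_filter => z /=; rewrite andbC. Qed.

Lemma free_SbF_closed F lam x : vars lam = [::] ->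
  free (SbF F lam x) = [seq y <- free F | y != x].
Proof.
move=> c; elim: F => //=.
- by move=> l m; rewrite filter_cat !vars_lsubst_closed.
- move=> _ ls; elim: ls => //= l ls IH.
  by rewrite filter_cat vars_lsubst_closed // IH.
- by move=> G -> H ->; rewrite filter_cat.
- by move=> G -> H ->; rewrite filter_cat.
- by move=> G -> H ->; rewrite filter_cat.
- by move=> G -> H ->; rewrite filter_cat.
- move=> y G IG; case: eqP => [->|_] /=; first by rewrite filter_id.
  by rewrite IG filter_neq_comm.
- move=> y G IG; case: eqP => [->|_] /=; first by rewrite filter_id.
  by rewrite IG filter_neq_comm.
Qed.

Lemma CF_closed F lam x : vars lam = [::] -> CF F lam x.
Proof.
move=> c; elim: F => //=.
- by move=> G -> H ->.
- by move=> G -> H ->.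
- by move=> G -> H ->.
- by move=> G -> H ->.
- by move=> y G ->; rewrite c orbT.
- by move=> y G ->; rewrite c orbT.
Qed.

Lemma SbF_notin F lam x : x \notin free F -> SbF F lam x = F.
Proof.
elim: F => //=.
- by move=> l m; rewrite mem_cat negb_or => /andP[? ?]; rewrite !lsubst_notin.
- move=> p ls h; congr FPred; elim: ls h => //= l ls IH.
  rewrite mem_cat negb_or => /andP[xl /IH ->].
  by rewrite lsubst_notin.
- by move=> G IG h; rewrite IG.
- by move=> G IG H IH; rewrite mem_cat negb_or => /andP[? ?]; rewrite IG ?IH.
- by move=> G IG H IH; rewrite mem_cat negb_or => /andP[? ?]; rewrite IG ?IH.
- by move=> G IG H IH; rewrite mem_cat negb_or => /andP[? ?]; rewrite IG ?IH.
- by move=> G IG H IH; rewrite mem_cat negb_or => /andP[? ?]; rewrite IG ?IH.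
- move=> y G IG; rewrite mem_filter negb_and negbK eq_sym.
  by case: eqP => //= _ h; rewrite IG.
- move=> y G IG; rewrite mem_filter negb_and negbK eq_sym.
  by case: eqP => //= _ h; rewrite IG.
Qed.

(** The number of connectives and quantifiers; it is invariant under
    substitution, so induction on it reaches the instances G(l/x) of the body
    of a quantified sentence. *)
Fixpoint fsize F : nat :=
  match F with
  | FEq _ _ | FPred _ _ => 0
  | FNeg G | FAll _ G | FEx _ G => (fsize G).+1
  | FImp G H | FIff G H | FAnd G H | FOr G H => (fsize G + fsize H).+1
  end.

Lemma fsize_SbF F lam x : fsize (SbF F lam x) = fsize F.
Proof.
elim: F => //=; try by [move=> ? -> | move=> ? -> ? ->].
- by move=> y G IG; case: eqP => //= _; rewrite IG.
- by move=> y G IG; case: eqP => //= _; rewrite IG.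
Qed.

End Formulas.

(** * Satisfaction *)

Lemma eq_map_nth (T U : Type) (x0 : T) (f g : T -> U) (s : seq T) :
  (forall i, i < size s -> f (nth x0 s i) = g (nth x0 s i)) ->
  map f s = map g s.
Proof.
elim: s => //= x s IH h; congr cons; first exact: (h 0).
by apply: IH => i; apply: (h i.+1).
Qed.

Lemma vars_nth (A : Type) (ls : seq (string A)) i : i < size ls ->
  {subset vars (nth [::] ls i) <= flatten (map (@vars A) ls)}.
Proof.
elim: ls i => //= l ls IH [|i] h y hy; rewrite mem_cat ?hy //.
by rewrite (IH i) ?orbT.
Qed.

Section Satisfaction.
Variables (A P : Type) (S : fms A P) (D : interpretation A P).
Hypotheses (hS : is_fms S) (hD : is_model S D).
Implicit Types (e : nat -> indiv D) (F G : formula (A + names D) P).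

Notation E := (lists (extended S D)).
Notation nm := (fun d : indiv D => name_list A (name d)).

(** The assignment e with the value at x changed to d. *)
Definition upd (T : Type) (e : nat -> T) x d : nat -> T :=
  fun y => if y == x then d else e y.

(** The value of a list under an assignment of individuals to the variables:
    the variables are replaced by the names of their individuals. *)
Definition eval e (l : string (A + names D)) : indiv D :=
  value (ssub l (fun y => nm (e y))).

(** Tarski satisfaction: quantifiers range over the individuals, and not over
    the closed lists denoting them. *)
Fixpoint sat F e : Prop :=
  match F with
  | FEq l m => eval e l = eval e m
  | FPred p ls => pred_of p (map (eval e) ls)
  | FNeg G => ~ sat G e
  | FImp G H => sat G e -> sat H e
  | FIff G H => sat G e <-> sat H e
  | FAnd G H => sat G e /\ sat H e
  | FOr G H => sat G e \/ sat H e
  | FAll x G => forall d, sat G (upd e x d)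
  | FEx x G => exists d, sat G (upd e x d)
  end.

Lemma closed_name d : closed_list S (nm d).
Proof. by split=> //; apply: ext_lists_name. Qed.

(** The axiom on [value] for the list consisting of a single variable, together
    with surjectivity. *)
Lemma value_name d : value (nm d) = d.
Proof.
have [l cl <-] := value_surj hD d.
have := @value_subst _ _ _ _ hD l 0 (svar 0) cl (ext_lists_var _ hS 0).
by rewrite /lsubst /= cats0 => h; rewrite [in RHS]h.
Qed.

Lemma closed_ssub l v : E l -> (forall x, closed_list S (v x)) ->
  closed_list S (ssub l v).
Proof.
move=> El cv; split; first by apply: ext_lists_ssub => // x; right; apply: cv.
rewrite vars_ssub; elim: (vars l) => //= y s ->.
by have [_ ->] := cv y.
Qed.

(** Replacing closed lists by closed lists of the same values does not change
    the value of a list: the axiom on [value] is applied to one variable at a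
    time, all the others being already replaced. *)
Lemma eq_value_ssub l v w : E l ->
  (forall x, closed_list S (v x)) -> (forall x, closed_list S (w x)) ->
  (forall x, value (v x) = value (w x)) -> value (ssub l v) = value (ssub l w).
Proof.
move=> El cv cw vw.
have -> : ssub l w = ssub l (fun y => if y \in vars l then w y else v y).
  by apply: eq_ssub => y ->.
elim: (vars l) => [|x xs IH]; first by [].
rewrite {}IH; set u := fun y : nat => if y \in xs then w y else v y.
have cu y : closed_list S (u y) by rewrite /u; case: ifP.
have uw y : value (u y) = value (w y) by rewrite /u; case: ifP.
(* All variables but x are already replaced by closed lists in m. *)
pose m := ssub l (upd u x (svar x)).
have Em : E m.
  apply: ext_lists_ssub => // y; rewrite /upd.
  by case: eqP => [->|_]; [left | right; apply: cu].
have mx : {subset vars m <= [:: x]}.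
  move=> y; rewrite /m vars_ssub => /flattenP[_ /mapP[z _ ->]].
  by rewrite /upd; case: eqP => // _; rewrite (proj2 (cu z)).
have mE k : lsubst m k x = ssub l (upd u x k).
  rewrite lsubst_ssub ssub_comp; apply: eq_ssub => y _; rewrite /upd.
  case: eqP => [_|_]; first by rewrite ssub_svar eqxx.
  by rewrite ssub_closed //; case: (cu y).
have -> : ssub l u = lsubst m (u x) x.
  by rewrite mE; apply: eq_ssub => y _; rewrite /upd; case: eqP => [->|].
have -> : ssub l (fun y => if y \in x :: xs then w y else v y) =
          lsubst m (w x) x.
  rewrite mE; apply: eq_ssub => y _; rewrite /upd inE.
  by case: eqP => [->|].
by rewrite (value_subst hD) // uw -(value_subst hD).
Qed.

Lemma eq_eval e1 e2 l : {in vars l, e1 =1 e2} -> eval e1 l = eval e2 l.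
Proof. by move=> h; congr value; apply: eq_ssub => y /h ->. Qed.

Lemma eval_svar e x : eval e (svar x) = e x.
Proof. by rewrite /eval ssub_svar value_name. Qed.

Lemma eval_closed e l : vars l = [::] -> eval e l = value l.
Proof. by move=> c; rewrite /eval ssub_closed. Qed.

(** The case of lists in the substitution lemma [sat_SbF]. *)
Lemma eval_lsubst e l lam x : E l -> E lam ->
  eval e (lsubst l lam x) = eval (upd e x (eval e lam)) l.
Proof.
move=> El Elam; rewrite /eval lsubst_ssub ssub_comp.
have cn y : closed_list S (nm (e y)) by apply: closed_name.
apply: eq_value_ssub => // y; rewrite ?/upd; last 2 first.
- exact: closed_name.
- case: eqP => _; last by rewrite ssub_svar.
  by rewrite value_name.
- by case: eqP => _; rewrite ?ssub_svar //; apply: closed_ssub.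
Qed.

(** Coincidence lemma: satisfaction depends only on the free variables. *)
Lemma eq_sat F e1 e2 : {in free F, e1 =1 e2} -> (sat F e1 <-> sat F e2).
Proof.
have updP (G : formula (A + names D) P) x (f1 f2 : nat -> indiv D) d :
    {in [seq y <- free G | y != x], f1 =1 f2} ->
    {in free G, upd f1 x d =1 upd f2 x d}.
  move=> h y yG; rewrite /upd; case: eqP => // /eqP yx.
  by apply: h; rewrite mem_filter yx.
have catP (s t : seq nat) (f1 f2 : nat -> indiv D) :
    {in s ++ t, f1 =1 f2} -> {in s, f1 =1 f2} /\ {in t, f1 =1 f2}.
  by move=> h; split=> y yst; apply: h; rewrite mem_cat yst ?orbT.
elim: F e1 e2 => /=.
- by move=> l m e1 e2 /catP[h1 h2]; rewrite (eq_eval h1) (eq_eval h2).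
- move=> p ls e1 e2 h; suff -> : map (eval e1) ls = map (eval e2) ls by [].
  apply: (@eq_map_nth _ _ [::]) => i ils.
  by apply: eq_eval => y /(vars_nth ils); apply: h.
- by move=> G IG e1 e2 /IG; tauto.
- by move=> G IG H IH e1 e2 /catP[/IG ? /IH ?]; tauto.
- by move=> G IG H IH e1 e2 /catP[/IG ? /IH ?]; tauto.
- by move=> G IG H IH e1 e2 /catP[/IG ? /IH ?]; tauto.
- by move=> G IG H IH e1 e2 /catP[/IG ? /IH ?]; tauto.
- by move=> x G IG e1 e2 h; split=> s d; apply/(IG _ _ (updP _ _ _ _ d h)).
- by move=> x G IG e1 e2 h; split=> -[d s]; exists d;
    apply/(IG _ _ (updP _ _ _ _ d h)).
Qed.

(** Substitution lemma. *)
Lemma sat_SbF F e lam x : formula_of (extended S D) F -> E lam ->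
  CF F lam x -> (sat (SbF F lam x) e <-> sat F (upd e x (eval e lam))).
Proof.
move=> + Elam; rewrite /formula_of.
have updC (G : formula (A + names D) P) y f d : y != x -> y \notin vars lam ->
    sat G (upd (upd f y d) x (eval (upd f y d) lam)) <->
    sat G (upd (upd f x (eval f lam)) y d).
  move=> yx ylam; apply: eq_sat => z _.
  rewrite (@eq_eval (upd f y d) f) => [|w wl].
    by rewrite /upd; case: (z =P x) => // ->; rewrite eq_sym (negbTE yx).
  by rewrite /upd; case: eqP ylam => // <-; rewrite wl.
elim: F e => /=.
- by move=> l m e [El Em] _; rewrite !eval_lsubst.
- move=> p ls e h _; rewrite -map_comp.
  suff -> : map (eval e \o (fun l => lsubst l lam x)) ls =
            map (eval (upd e x (eval e lam))) ls by [].
  apply: (@eq_map_nth _ _ [::]) => i ils /=.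
  by rewrite eval_lsubst //; apply: h.
- by move=> G IG e h c; have := IG e h c; tauto.
- by move=> G IG H IH e [/(IG e) ? /(IH e) ?] /andP[? ?]; tauto.
- by move=> G IG H IH e [/(IG e) ? /(IH e) ?] /andP[? ?]; tauto.
- by move=> G IG H IH e [/(IG e) ? /(IH e) ?] /andP[? ?]; tauto.
- by move=> G IG H IH e [/(IG e) ? /(IH e) ?] /andP[? ?]; tauto.
- move=> y G IG e h c.
  have [xF|xF] := boolP (x \in free (FAll y G)); last first.
    rewrite -[if _ then _ else _]/(SbF (FAll y G) lam x) SbF_notin //.
    apply: (@eq_sat (FAll y G)) => z zF; rewrite /upd.
    by case: eqP zF xF => // -> ->.
  move: c xF => /orP[/negP//|/andP[ylam c]] /=.
  rewrite mem_filter eq_sym => /andP[yx _]; rewrite (negbTE yx) /=.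
  by split=> s d; [apply/updC/IG | apply/IG/updC].
- move=> y G IG e h c.
  have [xF|xF] := boolP (x \in free (FEx y G)); last first.
    rewrite -[if _ then _ else _]/(SbF (FEx y G) lam x) SbF_notin //.
    apply: (@eq_sat (FEx y G)) => z zF; rewrite /upd.
    by case: eqP zF xF => // -> ->.
  move: c xF => /orP[/negP//|/andP[ylam c]] /=.
  rewrite mem_filter eq_sym => /andP[yx _]; rewrite (negbTE yx) /=.
  by split=> -[d s]; exists d;
    [apply/updC => //; apply/IG | apply/IG => //; apply/updC].
Qed.

(** * Truth, satisfaction and validity *)

Lemma formula_SbF F lam x : formula_of (extended S D) F -> E lam ->
  formula_of (extended S D) (SbF F lam x).
Proof.
by move=> h Elam; apply: args_in_SbF => // l El; apply: ext_lists_subst.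
Qed.

Lemma sentence_body F x l : args_in E F ->
  [seq y <- free F | y != x] = [::] -> closed_list S l ->
  sentence S (SbF F l x).
Proof.
move=> h c [El cl]; split; first exact: formula_SbF.
by rewrite free_SbF_closed.
Qed.

(** The assignment e is arbitrary, and enters only through the bound
    variables. *)
Lemma truth_sat F e : sentence S F -> (truth F <-> sat F e).
Proof.
have cat0 (s t : seq nat) : s ++ t = [::] -> s = [::] /\ t = [::].
  by case: s => //= ->.
have [n] := ubnP (fsize F); elim: n F e => // n IHn [] /=.
- move=> l m e _ sF; rewrite (truth_eq hD) //.
  by case: sF => _ /= /cat0[cl cm]; rewrite !eval_closed.
- move=> p ls e _ sF; rewrite (truth_pred hD) //.
  suff -> : map (eval e) ls = map (@value A P D) ls by [].
  case: sF => _ /= c; apply: (@eq_map_nth _ _ [::]) => i ils.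
  apply: eval_closed; case: (vars _) (vars_nth ils) => // y s.
  by rewrite c => /(_ y); rewrite inE eqxx => /(_ isT).
- move=> G e lt sF; rewrite (truth_neg hD) //.
  by case: sF => h c; have := IHn G e lt (conj h c); tauto.
- move=> G H e lt sF; rewrite (truth_imp hD) //.
  case: sF => -[/= hG hH] /cat0[cG cH].
  have := IHn G e (leq_ltn_trans (leq_addr _ _) lt) (conj hG cG).
  have := IHn H e (leq_ltn_trans (leq_addl _ _) lt) (conj hH cH); tauto.
- move=> G H e lt sF; rewrite (truth_iff hD) //.
  case: sF => -[/= hG hH] /cat0[cG cH].
  have := IHn G e (leq_ltn_trans (leq_addr _ _) lt) (conj hG cG).
  have := IHn H e (leq_ltn_trans (leq_addl _ _) lt) (conj hH cH); tauto.
- move=> G H e lt sF; rewrite (truth_and hD) //.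
  case: sF => -[/= hG hH] /cat0[cG cH].
  have := IHn G e (leq_ltn_trans (leq_addr _ _) lt) (conj hG cG).
  have := IHn H e (leq_ltn_trans (leq_addl _ _) lt) (conj hH cH); tauto.
- move=> G H e lt sF; rewrite (truth_or hD) //.
  case: sF => -[/= hG hH] /cat0[cG cH].
  have := IHn G e (leq_ltn_trans (leq_addr _ _) lt) (conj hG cG).
  have := IHn H e (leq_ltn_trans (leq_addl _ _) lt) (conj hH cH); tauto.
- move=> x G e lt sF; rewrite (truth_all hD) //; case: sF => /= h c.
  have key l : closed_list S l ->
      (truth (SbF G l x) <-> sat G (upd e x (value l))).
    move=> cl; rewrite (IHn _ e) ?fsize_SbF //; last exact: sentence_body.
    by case: cl => El cl; rewrite sat_SbF ?eval_closed //; apply: CF_closed.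
  split=> [s d|s l cl]; last by apply/key.
  by have [l cl <-] := value_surj hD d; apply/key/s.
- move=> x G e lt sF; rewrite (truth_ex hD) //; case: sF => /= h c.
  have key l : closed_list S l ->
      (truth (SbF G l x) <-> sat G (upd e x (value l))).
    move=> cl; rewrite (IHn _ e) ?fsize_SbF //; last exact: sentence_body.
    by case: cl => El cl; rewrite sat_SbF ?eval_closed //; apply: CF_closed.
  split=> [[l cl /(key _ cl) s]|[d]]; first by exists (value l).
  by have [l cl <-] := value_surj hD d => /(key _ cl); exists l.
Qed.

Lemma foldl_SbF_formula F xs lam : formula_of (extended S D) F ->
  (forall x, x \in xs -> closed_list S (lam x)) ->
  formula_of (extended S D) (foldl (fun G x => SbF G (lam x) x) F xs).
Proof.
elim: xs F => //= x xs IH F h c; apply: IH.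
  by apply: formula_SbF => //; case: (c x); rewrite ?mem_head.
by move=> y yxs; apply: c; rewrite inE yxs orbT.
Qed.

Lemma free_foldl_SbF F xs lam :
  (forall x, x \in xs -> closed_list S (lam x)) ->
  free (foldl (fun G x => SbF G (lam x) x) F xs) =
  [seq y <- free F | y \notin xs].
Proof.
elim: xs F => /= [|x xs IH] F c; first by rewrite filter_predT.
rewrite IH => [|y yxs]; last by apply: c; rewrite inE yxs orbT.
rewrite free_SbF_closed; last by case: (c x); rewrite ?mem_head.
rewrite -filter_predI; apply: eq_filter => y /=.
by rewrite inE negb_or andbC.
Qed.

Lemma sat_foldl_SbF F xs lam e : formula_of (extended S D) F ->
  (forall x, x \in xs -> closed_list S (lam x)) ->
  (sat (foldl (fun G x => SbF G (lam x) x) F xs) e <->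
   sat F (fun x => if x \in xs then value (lam x) else e x)).
Proof.
elim: xs F => /= [|x xs IH] F h c; first exact: eq_sat.
have [Ex cx] : closed_list S (lam x) by apply: c; rewrite mem_head.
rewrite IH; first last.
- by move=> y yxs; apply: c; rewrite inE yxs orbT.
- exact: formula_SbF.
rewrite sat_SbF ?CF_closed // eval_closed //; apply: eq_sat => y _.
by rewrite /upd inE; case: eqP => [->|].
Qed.

Lemma sentence_foldl_SbF F xs lam : formula_of (extended S D) F ->
  (forall x, x \in xs -> closed_list S (lam x)) -> {subset free F <= xs} ->
  sentence S (foldl (fun G x => SbF G (lam x) x) F xs).
Proof.
move=> h c Fxs; split; first exact: foldl_SbF_formula.
rewrite free_foldl_SbF //; apply/eqP; rewrite -size_eq0 size_filter -leqn0.
by rewrite leqNgt -has_count; apply/hasPn => y yF; rewrite negbK Fxs.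
Qed.

(** Validity, defined by substitution of closed lists, is satisfaction by all
    assignments, since every individual is the value of its name. *)
Lemma valid_sat F : formula_of (extended S D) F ->
  (valid S D F <-> forall e, sat F e).
Proof.
move=> h; split=> [vF e|sF xs lam _ xsF c]; last first.
  have [d0] := indiv_nonempty hD.
  apply/(@truth_sat _ (fun=> d0)); last exact/sat_foldl_SbF.
  by apply: sentence_foldl_SbF => // y; rewrite xsF.
pose lam x := nm (e x); pose xs := undup (free F).
have c x : x \in xs -> closed_list S (lam x) by move=> _; apply: closed_name.
have sent : sentence S (foldl (fun G x => SbF G (lam x) x) F xs).
  by apply: sentence_foldl_SbF => // y; rewrite mem_undup.
have /(truth_sat e sent) := vF xs lam (undup_uniq _) (mem_undup _) c.
move/(sat_foldl_SbF e h c); apply: (iffLR (eq_sat _)) => y _.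
by case: ifP => // _; rewrite value_name.
Qed.

(** * Soundness of the calculus *)

Lemma sat_pinst (Fs : nat -> formula (A + names D) P) a e :
  sat (pinst Fs a) e <-> peval (fun i => `[< sat (Fs i) e >]) a.
Proof.
elim: a => /= [i|b IH|b IHb c IHc|b IHb c IHc|b IHb c IHc|b IHb c IHc].
- by split=> /asboolP.
- by rewrite IH; split=> /negP.
- by rewrite IHb IHc; split=> /implyP.
- rewrite IHb IHc; split=> [h|/eqP -> //].
  by apply/eqP; apply/idP/idP => /h.
- by rewrite IHb IHc; split=> /andP.
- by rewrite IHb IHc; split=> /orP.
Qed.

Lemma sat_pred_cong p s e : sat (pred_cong (A + names D) p s) e.
Proof.
rewrite /pred_cong.
suff H (T : formula (A + names D) P) (t : seq (nat * nat)) :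
    (map (e \o fst) t = map (e \o snd) t -> sat T e) ->
    sat (foldr (fun xy G => FImp (FEq (svar xy.1) (svar xy.2)) G) T t) e.
  apply: (H) => /= h; rewrite -!map_comp.
  rewrite (eq_map (_ : _ =1 e \o fst)) => [|xy] /=; last exact: eval_svar.
  rewrite h [in X in _ -> X](eq_map (_ : _ =1 e \o snd)) => [|xy] //=.
  exact: eval_svar.
elim: t => [|[x y] t IH] /=; first by apply.
move=> h; rewrite !eval_svar => exy; apply: IH => et.
by apply: h; rewrite exy et.
Qed.

Lemma sat_log_axiom F e : log_axiom F -> formula_of (extended S D) F -> sat F e.
Proof.
case=> [a Fs /(_ _) ta _|x _|l m x y|p s _ _|x G _|x G H xG _|x G _] /=.
- exact/sat_pinst.
- by [].
- move=> [_ [_ h]] s; rewrite !eval_svar => exy.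
  (* Sending y to the value of x changes nothing, as e x = e y. *)
  have := @sat_SbF (FEq l m) e (svar x) y h (ext_lists_var _ hS x) isT.
  case=> /(_ s) + _; rewrite eval_svar /=.
  have Q : {in vars l ++ vars m, upd e y (e x) =1 e}.
    by move=> z _; rewrite /upd exy; case: eqP => [->|].
  rewrite !(eq_eval (e2 := e)) // => z zl; apply: Q;
    by rewrite mem_cat zl ?orbT.
- exact: sat_pred_cong.
- move=> /(_ (e x)); apply: (iffLR (eq_sat _)) => y _.
  by rewrite /upd; case: eqP => [->|].
- move=> s sG d; apply: s; apply: (iffLR (eq_sat _)) sG => y yG.
  by rewrite /upd; case: eqP yG xG => // -> ->.
- split=> [/existsNP[d /contrapT s]|[d s] /(_ d)]; last by [].
  by exists d.
Qed.

Lemma ext_basis_formula F :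
  basis (extended S D) F -> formula_of (extended S D) F.
Proof.
case=> G /(basis_formula hS); rewrite /formula_of => + ->.
have lift (l : string A) : lists S l -> E (map_string inl l).
  by move=> Sl; exists l, [::].
elim: G => //=.
- by move=> l m [/lift ? /lift].
- move=> _ ls h i; rewrite size_map => ils.
  by rewrite (nth_map [::]) //; apply/lift/h.
- by move=> G IG H IH [/IG ? /IH].
- by move=> G IG H IH [/IG ? /IH].
- by move=> G IG H IH [/IG ? /IH].
- by move=> G IG H IH [/IG ? /IH].
Qed.

(** Membership in the system is carried along, since the substitution lemma
    needs it. *)
Lemma provable_sat F : provable (extended S D) F ->
  formula_of (extended S D) F /\ forall e, sat F e.
Proof.
elim=> {F} [F bF|F aF fF|F G _ [_ sF] _ [[_ fG] sFG]|F lam x _ [fF sF] Elam c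
  |F x _ [fF sF]].
- have fF := ext_basis_formula bF.
  by split=> //; apply: (iffLR (valid_sat fF)); apply: basis_valid bF.
- by split=> // e; apply: sat_log_axiom.
- by split=> // e; exact: (sFG e (sF e)).
- by split=> [|e]; [exact: formula_SbF | exact/sat_SbF].
- by split=> // e d; apply: sF.
Qed.

End Satisfaction.

Theorem lemma3p5 (A P : Type) (S : fms A P) (hS : is_fms S)
    (D : interpretation A P) (hD : is_model S D)
    (F : formula (A + names D) P) (hF : formula_of (extended S D) F) :
  provable (extended S D) F -> valid S D F.
Proof.
by move=> pF; apply/valid_sat => //; case: (provable_sat hS hD pF).
Qed.
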